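(* Let $d\ge 2$ be an integer and let $R>0$ be a fixed real number. For every $\varepsilon$ with $0<\varepsilon<2dR$ there exist a real number $r$ with $0<r<R$ and a Delone set $X\subset\mathbb{R}^d$ of type $(r,R)$ such that $X$ is not a regular system and $N_X(2dR-\varepsilon)=1$.
   Context: For real numbers $0<r<R$, a set $X\subset\mathbb{R}^d$ is a Delone set of type $(r,R)$ if for every $y\in\mathbb{R}^d$ the open ball $\{x:|x-y|<r\}$ contains at most one point of $X$ and the closed ball $B_R(y)=\{x:|x-y|\le R\}$ contains at least one point of $X$. The symmetry group $S(X)$ consists of all isometries of $\mathbb{R}^d$ (proper or improper) mapping $X$ onto itself. A Delone set $X$ is a regular system if $S(X)$ acts transitively on the points of $X$. For $x\in X$ and $\rho\ge 0$ the $\rho$-cluster of $X$ at $x$ is $C_x(\rho)=B_\rho(x)\cap X$. Two $\rho$-clusters $C_x(\rho)$, $C_{x'}(\rho)$ (with $x,x'\in X$) are equivalent if there is an isometry $g$ of $\mathbb{R}^d$ with $g(x)=x'$ and $g(C_x(\rho))=C_{x'}(\rho)$ ($g$ need not be a symmetry of $X$). For $\rho>0$, $N_X(\rho)$ denotes the number of equivalence classes of $\rho$-clusters of $X$. *)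

(* Defs.v *)
From mathcomp Require Import all_boot all_order all_algebra finmap.
From mathcomp Require Import all_classical all_reals.
Set Implicit Arguments.
Unset Strict Implicit.
Unset Printing Implicit Defensive.
Import Order.TTheory GRing.Theory Num.Theory.
Local Open Scope classical_set_scope.
Local Open Scope ring_scope.

(* The library's norm `|x| on 'rV[K]_d is the sup norm, so the Euclidean
   distance is defined here. *)
Definition edist (K : realType) (d : nat) (x y : 'rV[K]_d) : K :=
  Num.sqrt (\sum_(i < d) (x 0 i - y 0 i) ^+ 2).

Definition open_eball (K : realType) (d : nat) (y : 'rV[K]_d) (r : K) :
  set 'rV[K]_d := [set x | edist x y < r].

Definition closed_eball (K : realType) (d : nat) (y : 'rV[K]_d) (r : K) :
  set 'rV[K]_d := [set x | edist x y <= r].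

Definition delone (K : realType) (d : nat) (r R : K) (X : set 'rV[K]_d) :
  Prop :=
  forall y : 'rV[K]_d,
    is_subset1 (X `&` open_eball y r) /\ X `&` closed_eball y R !=set0.

Definition eisometry (K : realType) (d : nat) (g : 'rV[K]_d -> 'rV[K]_d) :
  Prop :=
  bijective g /\ forall x y : 'rV[K]_d, edist (g x) (g y) = edist x y.

Definition symmetry_group (K : realType) (d : nat) (X : set 'rV[K]_d) :
  set ('rV[K]_d -> 'rV[K]_d) := [set g | eisometry g /\ g @` X = X].

(* The Delone condition on X is required separately. *)
Definition regular_system (K : realType) (d : nat) (X : set 'rV[K]_d) :
  Prop :=
  forall x y : 'rV[K]_d, X x -> X y -> exists2 g, symmetry_group X g & g x = y.

Definition cluster (K : realType) (d : nat) (X : set 'rV[K]_d) (rho : K)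
  (x : 'rV[K]_d) : set 'rV[K]_d := closed_eball x rho `&` X.

Definition cluster_equiv (K : realType) (d : nat) (X : set 'rV[K]_d) (rho : K)
  (x x' : 'rV[K]_d) : Prop :=
  exists g : 'rV[K]_d -> 'rV[K]_d,
    [/\ eisometry g, g x = x' & g @` cluster X rho x = cluster X rho x'].

(* Equivalence of clusters depends on their centres, so a class of clusters is
   represented by the set of the centres, in X, of its members. *)
Definition cluster_classes (K : realType) (d : nat) (X : set 'rV[K]_d)
  (rho : K) : set (set 'rV[K]_d) :=
  [set [set x' | X x' /\ cluster_equiv X rho x x'] | x in X].

(* N_X(rho); when there are infinitely many classes, fset_set yields the empty
   finite set and the value is 0. *)
Definition cluster_number (K : realType) (d : nat) (X : set 'rV[K]_d)
  (rho : K) : nat := #|` fset_set (cluster_classes X rho)|.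

(* Main.v *)
Require Import Defs.
From mathcomp Require Import all_boot all_order all_algebra finmap.
From mathcomp Require Import all_classical all_reals.
From mathcomp Require Import all_fingroup zify ring lra.
Import Order.TTheory GRing.Theory Num.Theory.
Local Open Scope classical_set_scope.
Local Open Scope ring_scope.

(** The set is a stack of parallel copies of one dense grid.  Write p = d - 1.
Layer k lies at height b * k, with b slightly below 2R, and consists of the
points whose p horizontal coordinates are multiples of c in prescribed classes
modulo 4: the i-th one is c * N with N = offset i k mod 4.  So each layer is a
translate of the cubic lattice of edge 4c, and a layer is obtained from the one
below it by a shift.  Since c is as small as desired, empty balls have radius
close to b / 2, hence at most R.

The shifts are chosen as follows.  Between layers k and k + 1 there is no shift
if k is even, and if k is odd exactly one axis is shifted, by c or by -c (a
quarter of the edge); the axes take turns cyclically, so each one is shifted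
once in every 2p consecutive transitions.  A ball of radius less than d * b
centred in layer k only meets the layers k - p, ..., k + p, which are separated
by 2p transitions.  In this window each axis is shifted exactly once, and
whichever signs were chosen can be undone by reflecting the axes separately.
Apart from signs, the window at an even layer shows the axes in some cyclic
order, and the window at an odd layer shows them in a reversed order upside
down; a permutation of the axes and, if needed, a reflection of the vertical
one take any window to any other [offset_equiv].  So all clusters of radius
below d * b are equivalent [layered_set_cluster_equiv], and b can be taken with
d * b > 2dR - eps.

The signs remain free, and offset i k = `|turn i k|, where turn i k counts the
shifts of axis i, makes every axis go down before layer 0 and up after it.
The ratio c^2 / b^2 is chosen to be irrational [small_incommensurable]; then
the distance 4pb between two points of the set only occurs vertically.  The
layers -2p and 2p, at this distance, lie exactly above each other, since
`|-1| = `|1|, whereas layer 4p is aligned neither with layer 0 nor with layer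
8p, since 2 differs from 0 and from 4 modulo 4.  Hence no symmetry moves a point
of layer -2p to one of layer 4p [layered_set_not_regular]. *)

(** * Euclidean distance and signed permutations of the coordinates *)

Section EuclideanSpace.
Context {K : realType} {d : nat}.
Implicit Types x y z : 'rV[K]_d.

Lemma sqr_edist x y : edist x y ^+ 2 = \sum_(i < d) (x 0 i - y 0 i) ^+ 2.
Proof. by rewrite sqr_sqrtr // sumr_ge0 // => i _; exact: sqr_ge0. Qed.

Lemma coord_le_edist x y i : `|x 0 i - y 0 i| <= edist x y.
Proof.
rewrite -(ler_pXn2r (n := 2)) ?nnegrE ?sqrtr_ge0 //.
rewrite real_normK ?num_real // sqr_edist (bigD1 i) //= lerDl.
by rewrite sumr_ge0 // => j _; exact: sqr_ge0.
Qed.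

Lemma edist_le x y (r : K) : 0 <= r ->
  \sum_(i < d) (x 0 i - y 0 i) ^+ 2 <= r ^+ 2 -> edist x y <= r.
Proof.
move=> r0 le_r; rewrite -(ler_pXn2r (n := 2)) ?nnegrE ?sqrtr_ge0 //.
by rewrite sqr_edist.
Qed.

Definition signed_perm_move (s : {perm 'I_d}) (sg : 'I_d -> bool) x y z :
    'rV[K]_d :=
  \row_i (y 0 i + (-1) ^+ sg i * (z 0 (s i) - x 0 (s i))).

Lemma signed_perm_move_base s sg x y : signed_perm_move s sg x y x = y.
Proof. by apply/rowP => i; rewrite mxE subrr mulr0 addr0. Qed.

Lemma signed_perm_move_isometry s sg x y :
  eisometry (signed_perm_move s sg x y).
Proof.
split.
  exists (signed_perm_move s^-1%g (fun i => sg ((s^-1)%g i)) y x) => z;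
    apply/rowP => i; rewrite !mxE ?permK ?permKV addrAC subrr add0r mulrA;
    by rewrite -signr_addb addbb mul1r addrC subrK.
move=> u v; rewrite /edist; congr Num.sqrt.
rewrite [RHS](reindex_inj (@perm_inj _ s)) /=; apply: eq_bigr => i _.
rewrite !mxE opprD addrACA subrr add0r -mulrBr exprMn sqrr_sign mul1r.
by congr (_ ^+ 2); ring.
Qed.

(** An isometry automatically matches the balls around [x] and [g x], so only
membership in [X] has to be compared, and only near [x]. *)
Lemma cluster_equiv_of_iff (X : set 'rV[K]_d) (rho : K) g x :
    eisometry g ->
    (forall z, edist z x <= rho -> X z <-> X (g z)) ->
  cluster_equiv X rho x (g x).
Proof.
move=> [bij_g iso_g] XgP; exists g; split=> //; apply/seteqP; split=> z /=.
  move=> [w [wx Xw] <-]; split; first by rewrite /closed_eball /= iso_g.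
  exact: (XgP w wx).1.
have [h hK gK] := bij_g; move=> [zx Xz].
have hx : edist (h z) x <= rho by rewrite -iso_g gK.
by exists (h z) => //; split=> //; apply: (XgP _ hx).2; rewrite gK.
Qed.

End EuclideanSpace.

Lemma cluster_number_eq1 (K : realType) (d : nat) (X : set 'rV[K]_d) (rho : K) :
    X !=set0 -> (forall x y, X x -> X y -> cluster_equiv X rho x y) ->
  cluster_number X rho = 1%N.
Proof.
move=> [x0 Xx0] Xeq; rewrite /cluster_number.
suff -> : cluster_classes X rho = [set X] by rewrite fset_set1 cardfs1.
have classX x : X x -> [set x' | X x' /\ cluster_equiv X rho x x'] = X.
  by move=> Xx; apply/seteqP; split=> [y [] //|y Xy]; split=> //; exact: Xeq.
apply/seteqP; split=> [_ [x Xx <-]|_ ->] /=; first exact: classX.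
by exists x0 => //; exact: classX.
Qed.

(** * The shifts between consecutive layers *)

Section Offsets.
Context {e : nat}.
Let p := e.+1.
Implicit Types (i : 'I_p) (k n : int).

(** Axis [i] is shifted in the transition from layer [k] to layer [k + 1] iff
[turn i] increases there, that is, iff [k + 1 + 2 * i] is a multiple of [2 * p].
The factor 2 leaves every other transition without a shift, which is what makes
even and odd layers mirror images of each other. *)
Definition turn i k : int := ((k + (2 * i)%:Z) %/ (2 * p)%:Z)%Z.
Definition phase i k : int := ((k + (2 * i)%:Z) %% (2 * p)%:Z)%Z.
(** The absolute value makes every shift of size 1, with a change of direction
that breaks global regularity without being visible in a bounded window. *)
Definition offset i k : int := `|turn i k|.

(** For an axis of phase [rho], tells whether its only shift within distance [p]
of the present layer lies between this layer and the one [n] steps above it (or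
[- n] steps below it, for negative [n]).  The shift is [2 * p - rho] steps up or [rho + 1] steps down, whichever is at most
[p]. *)
Definition jumped (rho n : int) : bool :=
  if p%:Z <= rho then (2 * p)%:Z - rho <= n else n <= - rho - 1.

Lemma jumped_reverse rho n :
  jumped ((2 * p)%:Z - 1 - rho) (- n) = jumped rho n.
Proof.
by rewrite /jumped; do 2!case: ifP; lia.
Qed.

Lemma turn_phase i k : k + (2 * i)%:Z = turn i k * (2 * p)%:Z + phase i k.
Proof. exact: divz_eq. Qed.

Lemma phase_bounds i k : 0 <= phase i k < (2 * p)%:Z.
Proof. by rewrite /phase modz_ge0 ?ltz_pmod. Qed.

Lemma turn_unique i k (q r : int) :
  k + (2 * i)%:Z = q * (2 * p)%:Z + r -> 0 <= r < (2 * p)%:Z -> turn i k = q.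
Proof.
by move=> eq_k r_bd; rewrite /turn eq_k divzMDl // divz_small ?addr0.
Qed.

(** A window of [2 * p] transitions contains a single shift of axis [i], so the
sign of this shift is all that the window knows of [offset i]. *)
Lemma offset_window i k : exists sg : bool, forall n, `|n| <= p%:Z ->
  offset i (k + n) - offset i k = (-1) ^+ sg * (jumped (phase i k) n)%:Z.
Proof.
have kE := turn_phase i k; have ph := phase_bounds i k.
move: kE ph; set q := turn i k; set r := phase i k => kE ph.
(* The sign of |q + 1| - |q| if the shift is above, of |q - 1| - |q| if below. *)
exists (if p%:Z <= r then q < 0 else 0 < q) => n np.
have turnE (t : int) : 0 <= r + n - t * (2 * p)%:Z < (2 * p)%:Z ->
    turn i (k + n) = q + t.
  by apply: turn_unique; rewrite mulrDl addrAC kE; ring.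
rewrite /offset -/q /jumped; case: ifP => rp.
  case: (boolP (_ <= n)) => jn.
    by rewrite (turnE 1); [case: (ltP q 0); rewrite ?expr0 ?expr1; lia|lia].
  by rewrite (turnE 0) ?addr0 ?subrr ?mulr0 //; lia.
case: (boolP (n <= _)) => jn.
  by rewrite (turnE (-1)); [case: (ltP 0 q); rewrite ?expr0 ?expr1; lia|lia].
by rewrite (turnE 0) ?addr0 ?subrr ?mulr0 //; lia.
Qed.

Lemma phase_inj k : injective (phase^~ k : 'I_p -> int).
Proof.
move=> i j eq_ph; have kj := turn_phase j k; have := turn_phase i k.
rewrite eq_ph; move: kj; move: (turn i k) (turn j k) => t t' eq_j eq_i.
have ip := ltn_ord i; have jp := ltn_ord j; apply: val_inj => /=.
have eq_ij : 2 * (i%:Z - j%:Z) = (t - t') * (2 * p)%:Z by lia.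
have [tt'|tt'|tt'] := ltrgtP t t'; [nia| nia|].
by move: eq_ij; rewrite tt' subrr mul0r; lia.
Qed.

(** All phases have the parity of [k].  They are distinct, so for [k] even they
are all the even numbers below [2 * p], and for [k] odd the same holds after the
reversal of [jumped_reverse]. *)
Lemma phase_perm k : exists (flip : bool) (s : {perm 'I_p}), forall i,
  (if flip then (2 * p)%:Z - 1 - phase i k else phase i k) = (2 * s i)%:Z.
Proof.
exists ((k %% 2)%Z == 1).
pose phi i :=
  if (k %% 2)%Z == 1 then (2 * p)%:Z - 1 - phase i k else phase i k.
have phiE i : exists j : 'I_p, phi i = (2 * j)%:Z.
  have ph := phase_bounds i k; have kE := turn_phase i k.
  have phi_even : (phi i %% 2)%Z = 0 /\ 0 <= phi i < (2 * p)%:Z.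
    by rewrite /phi; case: ifP; lia.
  have jp : (`|(phi i %/ 2)%Z| < p)%N by lia.
  by exists (Ordinal jp) => /=; lia.
have [s sE] := choice phiE.
have s_inj : injective s.
  move=> i j sij; apply: (@phase_inj k).
  by have := sE i; rewrite sij -sE /phi; case: ifP; lia.
by exists (perm s_inj) => i; rewrite permE -sE.
Qed.

(** Up to signs, a permutation of the axes and a reversal, the shifts seen from
layer [k] do not depend on [k]: the phases can be taken to be [2 * j]. *)
Lemma offset_pattern k :
  exists (flip : bool) (s : {perm 'I_p}) (sg : 'I_p -> bool),
  forall i n, `|n| <= p%:Z ->
    offset i (k + (-1) ^+ flip * n) - offset i k =
    (-1) ^+ sg i * (jumped (2 * s i)%:Z n)%:Z.
Proof.
have [flip [s sE]] := phase_perm k.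
have [sg sgE] := choice (offset_window ^~ k).
exists flip, s, sg => i n np; rewrite -sE sgE ?normrMsign //.
case: (flip); rewrite /= ?expr1 ?expr0 ?mul1r ?mulN1r //.
by rewrite -[in RHS](opprK n) jumped_reverse.
Qed.

(** Comparing both windows with the common pattern of [offset_pattern]. *)
Lemma offset_equiv k k' :
  exists (flip : bool) (s : {perm 'I_p}) (sg : 'I_p -> bool),
  forall i n, `|n| <= p%:Z ->
    offset i (k' + (-1) ^+ flip * n) - offset i k' =
    (-1) ^+ sg i * (offset (s i) (k + n) - offset (s i) k).
Proof.
have [f [s [sg E]]] := offset_pattern k.
have [f' [s' [sg' E']]] := offset_pattern k'.
exists (f (+) f'), (s' * s^-1)%g, (fun i => sg' i (+) sg ((s' * s^-1)%g i)).
move=> i n np; set j := (s' * s^-1)%g i.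
have sj : s j = s' i by rewrite /j permM permKV.
have nfp : `|(-1) ^+ f * n| <= p%:Z by rewrite normrMsign.
rewrite addbC signr_addb -mulrA E' //.
have := E j _ nfp; rewrite mulrA -signr_addb addbb mul1r => ->.
by rewrite sj mulrA -signr_addb addbK.
Qed.

End Offsets.

(** * The layered set *)

Section LayeredSet.
Context {K : realType} {e : nat} (b c : K).
Hypotheses (b_gt0 : 0 < b) (c_gt0 : 0 < c).
Let p := e.+1.
Implicit Types (k l : int) (N M : 'I_p -> int) (z : 'rV[K]_p.+1).

(** Coordinate [ord0] is the height; horizontal axis [i] is [lift ord0 i]. *)
Definition layer_point k N : 'rV[K]_p.+1 :=
  \row_i (if unlift ord0 i is Some j then c * (N j)%:~R else b * k%:~R).

Definition layered_set : set 'rV[K]_p.+1 :=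
  [set z | exists k N, z = layer_point k N /\
                       forall i, (N i = offset i k %[mod 4])%Z].

Lemma layer_point0 k N : layer_point k N 0 ord0 = b * k%:~R.
Proof. by rewrite mxE unlift_none. Qed.

Lemma layer_pointS k N i : layer_point k N 0 (lift ord0 i) = c * (N i)%:~R.
Proof. by rewrite mxE liftK. Qed.

Lemma eq_layer_point z k N :
  z 0 ord0 = b * k%:~R -> (forall i, z 0 (lift ord0 i) = c * (N i)%:~R) ->
  z = layer_point k N.
Proof.
move=> z0 zS; apply/rowP => i.
by case: (unliftP ord0 i) => [j ->|->]; rewrite ?layer_pointS ?layer_point0.
Qed.

Lemma sqr_edist_layer_point k N l M :
  edist (layer_point k N) (layer_point l M) ^+ 2 =
  b ^+ 2 * ((k - l) ^+ 2)%:~R + c ^+ 2 * (\sum_i (N i - M i) ^+ 2)%:~R.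
Proof.
rewrite sqr_edist big_ord_recl !layer_point0 -mulrBr exprMn -rmorphB rmorphXn.
congr (_ + _); rewrite rmorph_sum mulr_sumr; apply: eq_bigr => i _.
by rewrite !layer_pointS -mulrBr exprMn -rmorphB rmorphXn.
Qed.

Lemma layered_set_point k : layered_set (layer_point k (offset ^~ k)).
Proof. by exists k, (offset ^~ k). Qed.

Lemma lt_mul_int (a : K) (m n : int) : 0 < a ->
  `|a * m%:~R| < a * n%:~R -> `|m| < n.
Proof.
by move=> a0; rewrite normrM gtr0_norm // ltr_pM2l // -intr_norm ltr_int.
Qed.

(** Two points of a ball of radius [2 * c] differ by less than [4 * c] in every
coordinate, while distinct layers have heights at least [4 * c] apart and
distinct points of a layer differ by at least [4 * c] in some coordinate. *)
Lemma layered_set_uniformly_discrete y : 4 * c <= b ->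
  is_subset1 (layered_set `&` open_eball y (2 * c)).
Proof.
move=> cb _ _ [[k [N [-> kN]]] yx] [[l [M [-> lM]]] yx'].
have close i :
    `|layer_point k N 0 i - layer_point l M 0 i| < 4 * c.
  have := le_lt_trans (coord_le_edist _ _ i) yx.
  have := le_lt_trans (coord_le_edist _ _ i) yx'.
  by rewrite !ltr_norml => /andP[? ?] /andP[? ?]; apply/andP; split; lra.
have eq_kl : k = l.
  have := lt_le_trans (close ord0) cb; rewrite !layer_point0 -mulrBr -rmorphB.
  by rewrite -[ltRHS]mulr1 => /(@lt_mul_int _ _ 1 b_gt0); lia.
subst l; congr layer_point; apply/funext => i.
have := close (lift ord0 i); rewrite !layer_pointS -mulrBr -rmorphB mulrC.
rewrite -[4 * c]mulrC mulrC => /(@lt_mul_int _ _ 4 c_gt0).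
by have := kN i; have := lM i; lia.
Qed.

(** The nearest layer is at distance at most [b / 2]; inside it, rounding each
coordinate down to the grid is precise enough because [c] will be tiny. *)
Lemma layered_set_relatively_dense y (R : K) : 0 <= R ->
    b ^+ 2 / 4 + p%:R * (4 * c) ^+ 2 <= R ^+ 2 ->
  layered_set `&` closed_eball y R !=set0.
Proof.
move=> R0 bcR.
pose k := Num.floor (y 0 ord0 / b + 2^-1).
pose m (i : 'I_p) := Num.floor ((y 0 (lift ord0 i) / c - (offset i k)%:~R) / 4).
exists (layer_point k (fun i => offset i k + 4 * m i)); split.
  by exists k, (fun i => offset i k + 4 * m i); split => // i; lia.
rewrite /closed_eball /=; apply: edist_le => //; apply: le_trans bcR.
rewrite big_ord_recl layer_point0; apply: lerD.
  have /andP[] := floor_itv (y 0 ord0 / b + 2^-1); rewrite -/k rmorphD /=.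
  set t := y 0 ord0 / b; have -> : y 0 ord0 = b * t.
    by rewrite /t mulrC divfK ?gt_eqF.
  move=> kt tk; rewrite -mulrBr exprMn ler_pM2l ?exprn_gt0 //.
  suff : 0 <= (2^-1 - (k%:~R - t)) * (2^-1 + (k%:~R - t)) by lra.
  by apply: mulr_ge0; lra.
have cell i : (layer_point k (fun i => offset i k + 4 * m i) 0 (lift ord0 i)
    - y 0 (lift ord0 i)) ^+ 2 <= (4 * c) ^+ 2.
  rewrite layer_pointS; set t := (y 0 (lift ord0 i) / c - (offset i k)%:~R) / 4.
  have /andP[] := floor_itv t; rewrite -/(m i) rmorphD /= => mt tm.
  have -> : y 0 (lift ord0 i) = c * ((offset i k)%:~R + 4 * t).
    by rewrite /t; field; rewrite gt_eqF.
  rewrite -mulrBr !rmorphD rmorphM /= [X in X <= _]exprMn mulrC exprMn.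
  rewrite ler_pM2r ?exprn_gt0 // opprD addrACA subrr add0r -mulrBr exprMn.
  rewrite -[leRHS]mulr1 ler_pM2l ?exprn_gt0 //.
  suff : 0 <= (1 - ((m i)%:~R - t)) * (1 + ((m i)%:~R - t)) by lra.
  by apply: mulr_ge0; lra.
apply: (le_trans (ler_sum _ (fun i _ => cell i))).
by rewrite sumr_const card_ord [leRHS]mulr_natl.
Qed.

(** The bound on [rho] is what restricts the clusters to the [p] layers below
and the [p] layers above their centre, where [offset_equiv] applies. *)
Lemma layered_set_cluster_equiv (rho : K) x x' :
    rho < p.+1%:R * b -> layered_set x -> layered_set x' ->
  cluster_equiv layered_set rho x x'.
Proof.
move=> rho_lt [k [N [-> kN]]] [k' [N' [-> kN']]].
have [flip [s [sg offE]]] := @offset_equiv e k k'.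
set x0 := layer_point k N; set x0' := layer_point k' N'.
pose sgd i := if unlift ord0 i is Some j then sg j else flip.
pose g := signed_perm_move (lift_perm ord0 ord0 s) sgd x0 x0'.
have -> : x0' = g x0 by rewrite /g signed_perm_move_base.
apply: cluster_equiv_of_iff => [|z zx].
  exact: signed_perm_move_isometry.
have gz0 : g z 0 ord0 = b * k'%:~R + (-1) ^+ flip * (z 0 ord0 - b * k%:~R).
  by rewrite /g mxE lift_perm_id /sgd unlift_none !layer_point0.
have gzS i : g z 0 (lift ord0 i) =
    c * (N' i)%:~R + (-1) ^+ sg i * (z 0 (lift ord0 (s i)) - c * (N (s i))%:~R).
  by rewrite /g mxE lift_perm_lift /sgd liftK !layer_pointS.
have window n : z 0 ord0 = b * (k + n)%:~R -> `|n| <= p%:Z.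
  move=> z0; suff : `|n| < p.+1 by [].
  apply: (lt_mul_int _ _ _ b_gt0); rewrite [X in _ < X]mulrC.
  apply: le_lt_trans rho_lt; apply: le_trans zx.
  apply: le_trans (coord_le_edist _ _ ord0).
  by rewrite z0 layer_point0 rmorphD mulrDr addrAC subrr add0r.
split.
  move=> [l [M [zE lM]]].
  have /window np : z 0 ord0 = b * (k + (l - k))%:~R.
    by rewrite zE layer_point0 addrC subrK.
  exists (k' + (-1) ^+ flip * (l - k)).
  exists (fun i => N' i + (-1) ^+ sg i * (M (s i) - N (s i))); split.
    apply: eq_layer_point => [|i].
      rewrite gz0 zE layer_point0 [in RHS]rmorphD rmorphM rmorphB rmorph_sign.
      ring.
    rewrite gzS zE layer_pointS [in RHS]rmorphD rmorphM rmorphB rmorph_sign.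
    ring.
  move=> i; have := offE i _ np; rewrite [k + _]addrC subrK.
  have := kN (s i); have := kN' i; have := lM (s i).
  by case: (sg i); rewrite ?expr0 ?expr1 ?mul1r ?mulN1r; lia.
move=> [l [M [gzE lM]]].
pose n := (-1) ^+ flip * (l - k').
have z0 : z 0 ord0 = b * (k + n)%:~R.
  have := gz0; rewrite gzE layer_point0 /n => E.
  rewrite rmorphD rmorphM rmorphB /= rmorph_sign.
  by move: E; case: (flip); rewrite ?expr0 ?expr1; lra.
have np := window _ z0.
exists (k + n).
exists (fun j => let i := (s^-1)%g j in N j + (-1) ^+ sg i * (M i - N' i)).
have sV j : s ((s^-1)%g j) = j by rewrite permKV.
split.
  apply: eq_layer_point => // j /=.
  have := gzS ((s^-1)%g j); rewrite gzE layer_pointS sV.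
  rewrite rmorphD rmorphM rmorphB /= rmorph_sign.
  by case: (sg _); rewrite ?expr0 ?expr1; lra.
move=> j /=; have := offE ((s^-1)%g j) _ np; rewrite sV.
rewrite /n mulrA -signr_addb addbb mul1r [k' + _]addrC subrK.
have := kN j; have := kN' ((s^-1)%g j); have := lM ((s^-1)%g j).
by case: (sg _); rewrite ?expr0 ?expr1 ?mul1r ?mulN1r; lia.
Qed.

Lemma turn_period (i : 'I_p) (q : int) : turn i (q * (2 * p)%:Z) = q.
Proof.
by apply: (@turn_unique _ _ _ _ (2 * i)%:Z) => //; have := ltn_ord i; lia.
Qed.

(** The point [u] of layer [- 2 * p] has the point [v] of layer [2 * p] straight
above it.  A symmetry taking [u] to the point [w] of layer [4 * p] would produce
a point at the same distance from [w]; by incommensurability it would be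
straight below or above [w], in layer 0 or in layer [8 * p], whose offsets 0 and
4 are not congruent to 2. *)
Lemma layered_set_not_regular :
    (forall m q : int, b ^+ 2 * m%:~R = c ^+ 2 * q%:~R -> q = 0) ->
  ~ regular_system layered_set.
Proof.
move=> indep reg.
pose P : int := (2 * p)%:Z.
have offP (q : int) (i : 'I_p) : offset i (q * P) = `|q|.
  by rewrite /offset turn_period.
pose u := layer_point (- 1 * P) (fun=> 1).
pose v := layer_point (1 * P) (fun=> 1).
pose w := layer_point (2 * P) (fun=> 2).
have Xu : layered_set u.
  by exists (- 1 * P), (fun=> 1); split=> // i; rewrite offP.
have Xv : layered_set v.
  by exists (1 * P), (fun=> 1); split=> // i; rewrite offP.
have Xw : layered_set w.
  by exists (2 * P), (fun=> 2); split=> // i; rewrite offP.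
have [g [[_ iso_g] gX] gu] := reg u w Xu Xw.
have [l [M [gvE lM]]] : layered_set (g v) by rewrite -gX; exists v.
have := congr1 (fun t => t ^+ 2) (iso_g u v).
rewrite gu gvE !sqr_edist_layer_point => distE.
rewrite [in RHS]big1 in distE; last by move=> i _; rewrite subrr expr0n.
rewrite mulr0 addr0 in distE.
have S0 : \sum_i (2 - M i) ^+ 2 = 0 :> int.
  apply: (indep ((- 1 * P - 1 * P) ^+ 2 - (2 * P - l) ^+ 2)).
  rewrite rmorphB mulrBr -distE.
  by rewrite addrAC subrr add0r.
have M2 : M ord0 = 2.
  move: S0 => /eqP; rewrite psumr_eq0; last by move=> i _; exact: sqr_ge0.
  move=> /allP/(_ ord0 (mem_index_enum _)) /=.
  by rewrite sqrf_eq0 subr_eq0 => /eqP.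
move: distE; rewrite S0 mulr0 addr0.
move=> /(mulfI (lt0r_neq0 (exprn_gt0 2 b_gt0)))/intr_inj lP.
have := lM ord0; rewrite M2.
have : (2 * P - l - 2 * P) * (2 * P - l + 2 * P) = 0.
  by rewrite -subr_sqr lP; ring.
move=> /eqP; rewrite mulf_eq0 => /orP[]/eqP lE.
  by have -> : l = 0 * P; [lia | rewrite offP; lia].
by have -> : l = 4 * P; [lia | rewrite offP; lia].
Qed.

End LayeredSet.

(** * Choice of the parameters *)

Lemma sqr_eq_double_eq0 (x y : int) : x ^+ 2 = 2 * y ^+ 2 -> y = 0.
Proof.
move=> xy; apply/eqP/negPn/negP => y0.
have {}xy : (`|x| ^ 2 = 2 * `|y| ^ 2)%N.
  by rewrite -!abszX xy abszM.
have y_gt0 : (0 < `|y|)%N by rewrite absz_gt0.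
have := congr1 (logn 2) xy.
by rewrite lognM ?expn_gt0 ?y_gt0 // !lognX (@logn_prime 2 2) // eqxx; lia.
Qed.

(** Taking [c ^+ 2 / b ^+ 2] to be sqrt 2 / n for a large integer n, the last
property is the irrationality of sqrt 2. *)
Lemma small_incommensurable (K : realType) (b delta : K) :
    0 < b -> 0 < delta ->
  exists c : K, [/\ 0 < c, c ^+ 2 <= delta * b ^+ 2 &
    forall m q : int, b ^+ 2 * m%:~R = c ^+ 2 * q%:~R -> q = 0].
Proof.
move=> b0 delta0; set r2 : K := Num.sqrt 2.
have r20 : 0 < r2 by rewrite sqrtr_gt0.
have r2E : r2 ^+ 2 = 2 by rewrite sqr_sqrtr.
pose n := (Num.bound (r2 / delta)).+1.
have n_gt0 : 0 < n%:R :> K by rewrite ltr0n.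
have n_large : r2 / delta <= n%:R.
  apply: ltW; apply: lt_trans (archi_boundP _) _; first by rewrite ltW ?divr_gt0.
  by rewrite ltr_nat.
pose t := Num.sqrt (r2 / n%:R).
have tE : t ^+ 2 = r2 / n%:R by rewrite sqr_sqrtr // ltW ?divr_gt0.
exists (t * b); split.
- by rewrite mulr_gt0 // sqrtr_gt0 divr_gt0.
- rewrite exprMn ler_pM2r ?exprn_gt0 // tE ler_pdivrMr // mulrC -ler_pdivrMr //.
move=> m q; rewrite exprMn tE [_ * b ^+ 2]mulrC -[in RHS]mulrA.
move=> /(mulfI (lt0r_neq0 (exprn_gt0 2 b0))) mE.
have {}mE : m%:~R * n%:R = r2 * q%:~R by rewrite mE; field; rewrite gt_eqF.
apply: (@sqr_eq_double_eq0 (m * n%:Z)); apply: (@intr_inj K).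
by rewrite rmorphXn rmorphM /= -pmulrn mE exprMn r2E rmorphM rmorphXn.
Qed.

Theorem theorem5p8 (K : realType) (d : nat) (hd : (2 <= d)%N) (R : K)
  (hR : 0 < R) (eps : K) (heps0 : 0 < eps) (heps : eps < 2 * d%:R * R) :
  exists (r : K) (X : set 'rV[K]_d),
    [/\ 0 < r, r < R, delone r R X, ~ regular_system X
      & cluster_number X (2 * d%:R * R - eps) = 1%N].
Proof.
case: d hd heps => [|[|e]] // _ heps.
pose p := e.+1; rewrite -/p in heps *.
have d0 : 0 < p.+1%:R :> K by rewrite ltr0n.
(* Half of the tolerance [eps] is spent on keeping [b] below [2 * R]. *)
pose b := 2 * R - eps / (2 * p.+1%:R).
have db : p.+1%:R * b = 2 * p.+1%:R * R - eps / 2.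
  by rewrite /b; field; rewrite -natr1 addrC in d0; rewrite gt_eqF.
have b0 : 0 < b by rewrite -(pmulr_rgt0 _ d0) db; lra.
have b2R : b < 2 * R by rewrite /b ltrBlDr ltrDl divr_gt0 // mulr_gt0.
pose gap := R ^+ 2 - b ^+ 2 / 4.
have gap0 : 0 < gap.
  have -> : gap = (R - b / 2) * (R + b / 2) by rewrite /gap; field.
  by rewrite mulr_gt0; lra.
(* The first bound gives [4 * c <= b]; the second one makes the rounding errors
   along the [p] horizontal axes fit in [gap]. *)
pose delta := Num.min (16^-1) (gap / (16 * p%:R * b ^+ 2)).
have delta0 : 0 < delta.
  by rewrite lt_min invr_gt0 ltr0n divr_gt0 // !mulr_gt0 ?ltr0n ?exprn_gt0.
have [c [c0 c_small indep]] := small_incommensurable _ _ _ b0 delta0.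
have cb : 4 * c <= b.
  rewrite -(ler_pXn2r (n := 2)) ?nnegrE ?(ltW b0) ?mulr_ge0 ?(ltW c0) //.
  have : delta * b ^+ 2 <= 16^-1 * b ^+ 2.
    by rewrite ler_pM2r ?exprn_gt0 // ge_min lexx.
  by move/(le_trans c_small) => {}c_small; rewrite exprMn; lra.
have bcR : b ^+ 2 / 4 + p%:R * (4 * c) ^+ 2 <= R ^+ 2.
  rewrite addrC -lerBrDr -/gap exprMn.
  have : c ^+ 2 <= gap / (16 * p%:R).
    apply: (le_trans c_small).
    have : delta <= gap / (16 * p%:R * b ^+ 2) by rewrite ge_min lexx orbT.
    rewrite -(ler_pM2r (exprn_gt0 2 b0)) => /le_trans; apply.
    suff -> : gap / (16 * p%:R * b ^+ 2) * b ^+ 2 = gap / (16 * p%:R) by [].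
    by field; rewrite gt_eqF ?ltr0n // gt_eqF.
  rewrite ler_pdivlMr ?mulr_gt0 ?ltr0n // => c_le.
  by apply: le_trans c_le; lra.
exists (2 * c), (@layered_set K e b c); split.
- by rewrite mulr_gt0.
- lra.
- move=> y; split; first exact: layered_set_uniformly_discrete.
  by apply: layered_set_relatively_dense => //; exact: ltW.
- exact: layered_set_not_regular.
- apply: cluster_number_eq1.
    by exists (layer_point b c 0 (offset ^~ 0)); exact: layered_set_point.
  by move=> x y; apply: layered_set_cluster_equiv => //; rewrite db; lra.
Qed.
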